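(* Let $p>0$ and an ambiguity set $\mathcal{P}$ (a set of probability distributions of a positive random variable $H$) be given, and assume that: (i) $g(x):=\inf_{\mathbb{P}\in\mathcal{P}}\mathbb{P}\left(H<\frac{R-p}{W(x)}\right)$ is continuous; (ii) $\inf_{\mathbb{P}\in\mathcal{P}}\mathbb{P}\left(H<\frac{R-p}{W(x)}\right)$ is attained by some distribution $\mathbb{P}_x\in\mathcal{P}$ for every $x$. Then $\gamma_H^*=\gamma_H^*(p):=\inf_{\mathbb{P}\in\mathcal{P}}\gamma_H(p,\mathbb{P})$ is the unique solution to the equation $$\gamma_H^*=\lambda\cdot\inf_{\mathbb{P}\in\mathcal{P}}\mathbb{P}\left(H<\frac{R-p}{W(\gamma_H^* )}\right).$$
   Context: Customers arrive according to a Poisson process with rate $\lambda$. $H$ is the random delay cost rate of a customer, $R$ the utility of receiving service, $p$ the price, and $W(\gamma)$ the announced expected delay, a continuous function that increases with the effective arrival rate $\gamma$ (a standard choice is $W(\gamma)=\frac{\gamma}{\theta(\theta-\gamma)}$, the expected waiting time in an M/M/1 queue with service rate $\theta$). A customer with delay cost rate $h$ joins if $p+hW(\gamma)<R$. For a distribution $\mathbb{P}$ of $H$, the effective arrival rate $\gamma_H(p,\mathbb{P})$ is defined as the solution $\gamma_H$ of $\gamma_H=\lambda\,\mathbb{P}\left(H\le\frac{R-p}{W(\gamma_H)}\right)$, with $\gamma_H(p,\mathbb{P}):=\infty$ if no solution exists. It is assumed that for every $p$ there is at least one $\mathbb{P}\in\mathcal{P}$ with $\gamma_H(p,\mathbb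{P})<\infty$.
   Formalization: The effective arrival rate is defined with P(H < (R-p)/W), matching the joining rule p+hW<R, instead of P(H ≤ (R-p)/W); with ≤ the claim fails when an optimal law has an atom at the threshold. *)

(* Defs.v *)
From HB Require Import structures.
From mathcomp Require Import all_boot all_order all_algebra.
From mathcomp Require Import all_classical all_reals all_analysis.

Set Implicit Arguments.
Unset Strict Implicit.
Unset Printing Implicit Defensive.

Import Order.TTheory GRing.Theory Num.Theory.
Import numFieldNormedType.Exports.

Local Open Scope classical_set_scope.
Local Open Scope ring_scope.

(* Laws of the delay cost rate H: H is the identity on the real line. *)
Definition law (R : realType) := probability (measurableTypeR R) R.

(* The law of a positive random variable. *)
Definition positive_law (R : realType) (P : law R) : Prop :=
  P [set h | 0 < h] = 1%E.

(* Arrival rates at which the delay function is defined. Here theta = +oo is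
   a delay function on the whole half-line, and a finite theta is the service
   rate in W x = x / (theta * (theta - x)). *)
Definition rates (R : realType) (theta : \bar R) : set R :=
  [set x | 0 <= x /\ (x%:E < theta)%E].

(* The quotient is taken in \bar R, where 0^-1 = +oo and 0 * +oo = 0. So if
   W x = 0, as for the M/M/1 delay at x = 0, it is +oo, 0 or -oo according to
   the sign of u - p, and {H < (u - p) / W x} agrees with the joining rule
   p + H * W x < u on positive H. *)
Definition threshold (R : realType) (W : R -> R) (u p x : R) : \bar R :=
  ((u - p)%:E / (W x)%:E)%E.

Definition join_prob (R : realType) (W : R -> R) (u p x : R) (P : law R) :
    \bar R :=
  P [set h | (h%:E < threshold W u p x)%E].

(* xget takes the solution of the fixed-point equation when there is one (it is
   then unique for the increasing W considered here), and +oo otherwise.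
   The inequality is strict, as in the joining rule. With the event
   {H <= threshold} here and a strict inequality in worst_join_prob, the infimum
   of gammaH over an ambiguity set need not solve the worst-case equation: a law
   with an atom at the threshold may be optimal in worst_join_prob and yet have
   no effective arrival rate. *)
Definition gammaH (R : realType) (lambda : R) (theta : \bar R) (W : R -> R)
    (u p : R) (P : law R) : \bar R :=
  xget +oo%E [set x%:E | x in
    [set x | rates theta x /\ (x%:E = lambda%:E * join_prob W u p x P)%E]].

Definition worst_join_prob (R : realType) (W : R -> R) (u p : R)
    (PP : set (law R)) (x : R) : \bar R :=
  ereal_inf [set join_prob W u p x P | P in PP].

Definition gammaH_star (R : realType) (lambda : R) (theta : \bar R)
    (W : R -> R) (u p : R) (PP : set (law R)) : \bar R :=
  ereal_inf [set gammaH lambda theta W u p P | P in PP].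

(* Main.v *)
Require Import Defs.
From HB Require Import structures.
From mathcomp Require Import all_boot all_order all_algebra.
From mathcomp Require Import all_classical all_reals all_analysis.
Import Order.TTheory GRing.Theory Num.Theory.
Import numFieldNormedType.Exports.
Local Open Scope classical_set_scope.
Local Open Scope ring_scope.

(** The joining probability of each law, hence the worst case [g], is
nonincreasing in the rate, so [x - lambda * g x] is strictly increasing and has
at most one zero. It is nonpositive at [0] and nonnegative at the effective
arrival rate of a law in the ambiguity set, since [g] is below that law's
joining probability; by continuity it has a zero [x]. The same comparison puts
every effective arrival rate above [x], and the law attaining the infimum at [x]
has effective arrival rate [x]. *)

Lemma measurable_EFin_lt {R : realType} (t : \bar R) :
  measurable ([set h : measurableTypeR R | (h%:E < t)%E]).
Proof.
case: t => [r||].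
- rewrite (_ : [set h | _] = `]-oo, r[%classic); first exact: measurable_itv.
  by apply/seteqP; split=> h /=; rewrite in_itv /= lte_fin.
- rewrite (_ : [set h | _] = setT); first exact: measurableT.
  by apply/seteqP; split=> h //= _; exact: ltry.
- rewrite (_ : [set h | _] = set0); first exact: measurable0.
  by apply/seteqP; split=> h //=; rewrite ltNge leNye.
Qed.

Lemma join_prob_ge0 {R : realType} (W : R -> R) (u p x : R) (P : law R) :
  (0 <= join_prob W u p x P)%E.
Proof. exact: measure_ge0. Qed.

Lemma join_prob_le1 {R : realType} (W : R -> R) (u p x : R) (P : law R) :
  (join_prob W u p x P <= 1)%E.
Proof. by apply: probability_le1; exact: measurable_EFin_lt. Qed.

(** A nonpositive threshold puts the joining event inside the complement of [0 < h], a null set for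
    a positive law. *)
Lemma join_prob_eq0 {R : realType} (W : R -> R) (u p x : R) (P : law R) :
  positive_law P -> (threshold W u p x <= 0)%E -> join_prob W u p x P = 0%E.
Proof.
move=> Ppos t_le0; apply/eqP; rewrite -measure_le0.
have mpos : measurable ([set h | 0 < h] : set (measurableTypeR R)).
  rewrite (_ : [set h | _] = `]0, +oo[%classic); first exact: measurable_itv.
  by apply/seteqP; split=> h /=; rewrite in_itv /= andbT.
have <- : P (~` [set h | 0 < h]) = 0%E.
  by rewrite probability_setC// [P _]Ppos subee.
apply: le_measure; rewrite ?inE;
  [exact: measurable_EFin_lt|exact: measurableC|].
move=> h /= /lt_le_trans/(_ t_le0); rewrite lte_fin => h0.
by apply/negP; rewrite -leNgt ltW.
Qed.

Lemma threshold_le0 {R : realType} (W : R -> R) (u p x : R) :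
  u <= p -> 0 <= W x -> (threshold W u p x <= 0)%E.
Proof.
move=> up Wx; apply: mule_le0_ge0; first by rewrite lee_fin subr_le0.
by rewrite inve_ge0 lee_fin.
Qed.

(** Inversion is antitone on the nonnegative extended reals, 0 included since [0^-1 = +oo], so the
    case [W x = 0] is covered too. *)
Lemma threshold_anti {R : realType} (W : R -> R) (u p x y : R) :
  p <= u -> 0 <= W x -> W x <= W y ->
  (threshold W u p y <= threshold W u p x)%E.
Proof.
move=> pu Wx Wxy; apply: lee_wpmul2l; first by rewrite lee_fin subr_ge0.
by rewrite lee_pV2 ?inE ?lee_fin// (le_trans Wx).
Qed.

(* For [p <= u] the threshold decreases with the delay. For [u < p] it increases
   instead, but stays negative, where a positive law has no mass. *)
Lemma join_prob_anti {R : realType} {W : R -> R} (u p : R) {x y : R}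
    {P : law R} :
  positive_law P -> 0 <= W x -> W x <= W y ->
  (join_prob W u p y P <= join_prob W u p x P)%E.
Proof.
move=> Ppos Wx Wxy; have [up|/ltW pu] := leP u p.
  by rewrite join_prob_eq0 ?join_prob_ge0// threshold_le0// (le_trans Wx).
apply: le_measure; rewrite ?inE; [exact: measurable_EFin_lt..|].
by move=> h /= /lt_le_trans; apply; exact: threshold_anti.
Qed.

Lemma worst_join_prob_anti {R : realType} (W : R -> R) (u p x y : R)
    (PP : set (law R)) :
  (forall P, PP P -> positive_law P) -> 0 <= W x -> W x <= W y ->
  (worst_join_prob W u p PP y <= worst_join_prob W u p PP x)%E.
Proof.
move=> Ppos Wx Wxy; apply/ereal_infP => _ [P PPP <-].
apply: le_trans (join_prob_anti u p (Ppos _ PPP) Wx Wxy).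
by apply: ereal_inf_lbound; exists P.
Qed.

(** If [y < x], then [x = lambda * f x <= lambda * f y <= lambda * h y = y], a contradiction. Taking
    [h = f] gives uniqueness; taking [f] as the worst case and [h] as the joining probability of one
    law compares their solutions. *)
Lemma fixpoint_le {R : realType} {D : set R} {lambda : R} {f h : R -> \bar R}
    {x y : R} :
  0 <= lambda ->
  (forall a b, D a -> D b -> a < b -> (f b <= f a)%E) ->
  D x -> D y -> (f y <= h y)%E ->
  (x%:E = lambda%:E * f x)%E -> (y%:E = lambda%:E * h y)%E -> x <= y.
Proof.
move=> l0 fanti Dx Dy fhy xE yE; rewrite leNgt; apply/negP => yx.
suff : x <= y by rewrite leNgt yx.
rewrite -lee_fin xE yE; apply: lee_wpmul2l; first by rewrite lee_fin.
exact: le_trans (fanti _ _ Dy Dx yx) fhy.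
Qed.

(** Finiteness of [g] moves the equation to the reals, where the intermediate value theorem applies
    to [k x = x - lambda * g x]: it is nonpositive at 0 because [g] is nonnegative, and nonnegative
    at [b] by the last hypothesis. *)
Lemma continuous_fixpoint {R : realType} {lambda b : R} {g : R -> \bar R} :
  0 <= lambda -> 0 <= b -> (forall x, (0 <= g x)%E) ->
  (forall x, g x \is a fin_num) ->
  {within `[0, b], continuous g} -> (lambda%:E * g b <= b%:E)%E ->
  exists2 x, x \in `[0, b] & (x%:E = lambda%:E * g x)%E.
Proof.
move=> l0 b0 g0 gfin gc gb.
pose k x := x - lambda * fine (g x).
have kc : {within `[0, b], continuous k}.
  move=> x; apply: cvgB.
    by apply: (@continuous_subspaceT _ _ _ id) => z; exact: cvg_id.
  apply: cvgMl_tmp; apply: fine_cvg; rewrite fineK//; exact: gc.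
have gE x : (lambda%:E * g x = (lambda * fine (g x))%:E)%E.
  by rewrite EFinM fineK.
have k0 : k 0 <= 0 by rewrite /k sub0r oppr_le0 mulr_ge0 ?fine_ge0.
have kb : 0 <= k b by rewrite /k subr_ge0 -lee_fin -gE.
have [|x xb /eqP] := IVT (v := 0) b0 kc.
  by rewrite ge_min k0 le_max kb orbT.
rewrite subr_eq0 => /eqP xE; exists x => //.
by rewrite gE -xE.
Qed.

Lemma gammaHP {R : realType} (lambda : R) (theta : \bar R) (W : R -> R)
    (u p : R) (P : law R) :
  gammaH lambda theta W u p P = +oo%E \/
  exists x, [/\ gammaH lambda theta W u p P = x%:E, rates theta x &
    (x%:E = lambda%:E * join_prob W u p x P)%E].
Proof.
rewrite /gammaH; case: xgetP => [y yE [x [rx xE] yx]|_]; last by left.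
by right; exists x; split.
Qed.

Theorem theorem5p3 (R : realType) (lambda u p : R) (theta : \bar R)
    (W : R -> R) (PP : set (law R))
    (lambda_gt0 : 0 < lambda)
    (theta_gt0 : (0 < theta)%E)
    (W_ge0 : forall x, rates theta x -> 0 <= W x)
    (W_continuous : {within rates theta, continuous W})
    (W_increasing : forall x y, rates theta x -> rates theta y ->
       x < y -> W x < W y)
    (PP_positive : forall P, PP P -> positive_law P)
    (PP_finite_rate : forall q : R, 0 < q ->
       exists2 P, PP P & (gammaH lambda theta W u q P < +oo)%E)
    (p_gt0 : 0 < p)
    (g_continuous :
       {within rates theta, continuous (worst_join_prob W u p PP)})
    (g_attained : forall x, rates theta x ->
       exists2 P, PP P & join_prob W u p x P = worst_join_prob W u p PP x) :
  exists2 x : R, gammaH_star lambda theta W u p PP = x%:E &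
    unique (fun y : R => rates theta y /\
      (y%:E = lambda%:E * worst_join_prob W u p PP y)%E) x.
Proof.
have l0 := ltW lambda_gt0.
set g := worst_join_prob W u p PP.
have g_le P x : PP P -> (g x <= join_prob W u p x P)%E.
  by move=> PPP; apply: ereal_inf_lbound; exists P.
have g_ge0 x : (0 <= g x)%E.
  by apply/ereal_infP => _ [P _ <-]; exact: join_prob_ge0.
have W_le a b : rates theta a -> rates theta b -> a < b -> W a <= W b.
  by move=> ra rb ab; apply/ltW/W_increasing.
have g_anti a b : rates theta a -> rates theta b -> a < b -> (g b <= g a)%E.
  by move=> ra rb ab; apply: worst_join_prob_anti; [|exact: W_ge0|exact: W_le].
(* The finite effective arrival rate [b] of [P0] serves as the right end of the interval searched
   for a fixed point. *)
have [P0 PP0 gamma_fin] := PP_finite_rate _ p_gt0.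
have g_fin x : g x \is a fin_num.
  rewrite ge0_fin_numE//; apply: le_lt_trans (g_le _ x PP0) _.
  exact: le_lt_trans (join_prob_le1 _ _ _ _ _) (ltry 1).
have [gammay|[b [_ rb bE]]] := gammaHP lambda theta W u p P0.
  by rewrite gammay ltxx in gamma_fin.
have sub_rates : `[0, b] `<=` rates theta.
  move=> x /=; rewrite in_itv /= => /andP[x0 xb]; split=> //.
  by apply: le_lt_trans rb.2; rewrite lee_fin.
have gb : (lambda%:E * g b <= b%:E)%E.
  by rewrite [leRHS]bE; apply: lee_wpmul2l; [rewrite lee_fin|exact: g_le].
have [x xb xE] := continuous_fixpoint l0 rb.1 g_ge0 g_fin
  (continuous_subspaceW sub_rates g_continuous) gb.
have rx : rates theta x by exact: sub_rates.
exists x; last first.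
  (* Two solutions for [g] bound each other, by [fixpoint_le] with both functions equal to [g]. *)
  split=> // y [ry yE]; apply/eqP; rewrite eq_le.
  by rewrite (fixpoint_le l0 g_anti rx ry _ xE yE)//
             (fixpoint_le l0 g_anti ry rx _ yE xE).
apply/eqP; rewrite eq_le; apply/andP; split; last first.
  (* [x] is a lower bound: a law without a solution has rate [+oo], and any other has a joining
     probability above [g]. *)
  apply/ereal_infP => _ [P PPP <-].
  have [->|[y [-> ry yE]]] := gammaHP lambda theta W u p P; first exact: leey.
  rewrite lee_fin.
  apply: (fixpoint_le (h := join_prob W u p ^~ P) l0 g_anti rx ry _ xE yE).
  exact: g_le.
(* At [x] this law has joining probability [g x], so [x] solves its own equation and the lower bound
   is reached. *)
have [P PPP Px] := g_attained _ rx.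
apply: ereal_inf_lbound; exists P => //.
pose j a := join_prob W u p a P.
have j_anti a c : rates theta a -> rates theta c -> a < c -> (j c <= j a)%E.
  move=> ra rc ac.
  by apply: join_prob_anti; [exact: PP_positive|exact: W_ge0|exact: W_le].
have jE : (x%:E = lambda%:E * j x)%E by rewrite /j Px.
(* [xget] may pick any solution, so [x] must be the only one for this law; [j] being antitone
   ensures it. *)
apply: xget_unique; first by exists x.
move=> _ [y [ry yE] <-]; congr EFin; apply/eqP; rewrite eq_le.
rewrite (fixpoint_le (h := j) l0 j_anti ry rx (lexx _) yE jE).
by rewrite (fixpoint_le (h := j) l0 j_anti rx ry (lexx _) jE yE).
Qed.
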